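(* Every finite simple graph $G=(V,E)$ with minimum degree $\delta\geq 10^6$ can be decomposed into two $\{1,2\}$-weight colourable subgraphs; that is, $E$ can be partitioned into $E_1$ and $E_2$ such that for each $i\in\{1,2\}$ the graph $G_i=(V,E_i)$ is $\{1,2\}$-weight colourable.
   Context: A graph $F=(V,E)$ is $\{1,2\}$-weight colourable if there is a function $c:E\to\{1,2\}$ such that, writing $d_c(v):=\sum_{u\in N_F(v)}c(uv)$ for the weighted degree of $v$ in $F$, we have $d_c(u)\neq d_c(v)$ for every edge $uv\in E$. *)

(* Defs.v *)
From mathcomp Require Import all_boot.
Set Implicit Arguments. Unset Strict Implicit. Unset Printing Implicit Defensive.

Definition simple_graph (T : finType) (e : rel T) : Prop :=
  symmetric e /\ irreflexive e.

Definition deg (T : finType) (e : rel T) (v : T) : nat := #|[set u | e v u]|.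

Definition min_deg_ge (T : finType) (e : rel T) (d : nat) : Prop :=
  forall v : T, d <= deg e v.

Definition wdeg (T : finType) (F : rel T) (c : T -> T -> nat) (v : T) : nat :=
  \sum_(u | F v u) c v u.

(* F is {1,2}-weight colourable: there is c : E(F) -> {1,2} (represented as a
   symmetric function on pairs, only its values on edges matter) such that
   adjacent vertices get distinct weighted degrees. *)
Definition weight12_colourable (T : finType) (F : rel T) : Prop :=
  exists c : T -> T -> nat,
    (forall u v, F u v -> c u v = c v u) /\
    (forall u v, F u v -> c u v = 1 \/ c u v = 2) /\
    (forall u v, F u v -> wdeg F c u <> wdeg F c v).

(* Main.v *)
Require Import Defs.
From mathcomp Require Import all_boot zify.
Set Implicit Arguments. Unset Strict Implicit. Unset Printing Implicit Defensive.

(** Let [b] be a maximum 2-cut of the graph and, inside the two sides, let [r]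
    be a maximum 100-cut.  Edges across [b] are blue, edges inside a side whose
    ends have different [r] are red, and the few remaining edges are blue.  A
    red sum modulo 200 in [{2r, 2r+1}] separates the ends of a red edge, a blue
    sum modulo 4 in [{2b, 2b+1}] separates the ends of a blue edge across [b],
    and the blue edges inside a side are handled by choosing for each vertex,
    greedily, a set of permitted blue sums disjoint from those of its
    neighbours on its side.  This succeeds because these conflicts are a small
    fraction of the cut degree.  Vertices of small red degree, whose residue
    cannot be controlled, are harmless: red edges between two of them are made
    blue, and elsewhere their red sums are too small to cause a conflict.

    In both colours the weights are produced by a bipartite form of a theorem
    of Addario-Berry, Dalal and Reed: there is a subgraph in which every vertex
    [v] has degree in [{l, l+1, h, h+1}], for any [l = l(v)] below and [h = h(v)]
    above half of its degree that are not too far apart. *)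

Lemma exists_subset_card (T : finType) (A : {set T}) m :
  m <= #|A| -> exists2 B : {set T}, B \subset A & #|B| = m.
Proof.
move=> le_m; exists [set x in take m (enum A)].
  by apply/subsetP => x; rewrite inE => /mem_take; rewrite mem_enum.
by rewrite cardsE (card_uniqP _) ?take_uniq ?enum_uniq // size_takel -?cardE.
Qed.

Lemma exists_subset_card_mem (T : finType) (A : {set T}) a m :
  a \in A -> m < #|A| ->
  exists B : {set T}, [/\ B \subset A, a \in B & #|B| = m.+1].
Proof.
move=> Aa; rewrite (cardsD1 a) Aa add1n ltnS => /exists_subset_card[B sB cB].
exists (a |: B); rewrite setU11 cardsU1 cB subUset sub1set Aa.
rewrite (subset_trans sB (subsetDl _ _)) (contraFN (subsetP sB a)) //.
by rewrite !inE eqxx.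
Qed.

(** * Row and column degrees, and alternating paths *)

Section Bipartite.
Variables X Y : finType.
Implicit Types (F H : X -> Y -> bool) (x z w : X) (y u : Y).

Definition rdeg F x := \sum_y F x y.
Definition cdeg F y := \sum_x F x y.

Definition upd F x y b : X -> Y -> bool :=
  fun x' y' => if (x' == x) && (y' == y) then b else F x' y'.

Lemma rdeg_upd F x y b z :
  rdeg (upd F x y b) z + (z == x) * F x y = rdeg F z + (z == x) * b.
Proof.
rewrite /rdeg (bigD1 y) //= [in RHS](bigD1 y) //= /upd eqxx andbT.
rewrite (eq_bigr (fun j => F z j : nat)); first by case: eqP => [->|_]; lia.
by move=> j /negPf ->; rewrite andbF.
Qed.

Lemma cdeg_upd F x y b u :
  cdeg (upd F x y b) u + (u == y) * F x y = cdeg F u + (u == y) * b.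
Proof.
rewrite /cdeg (bigD1 x) //= [in RHS](bigD1 x) //= /upd eqxx andTb.
rewrite (eq_bigr (fun j => F j u : nat)); first by case: eqP => [->|_]; lia.
by move=> j /negPf ->.
Qed.

(** One step trades the edge [z y] of [F] for the new edge [x y]: column [y] keeps its degree and
    one unit of degree moves from row [z] to row [x]. *)
Definition alt_step H F : rel X :=
  [rel x z | [exists y, [&& H x y, ~~ F x y & F z y]]].

Lemma alternating_path_flip H F x p :
  (forall z y, F z y -> H z y) ->
  path (alt_step H F) x p -> uniq (x :: p) ->
  exists F',
    [/\ [/\ (forall z, z \notin x :: p -> F' z =1 F z),
            (forall y, F x y -> F' x y) &
            (forall y, F' (last x p) y -> F (last x p) y)],
        (forall z, rdeg F' z + (z == last x p) = rdeg F z + (z == x)),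
        (forall y, cdeg F' y = cdeg F y),
        (forall z y, F' z y -> H z y) &
        (forall z y, F' z y != F z y ->
           z \in x :: p /\ exists2 w, w \in x :: p & H w y && ~~ F w y)].
Proof.
move=> sFH; elim: p x => [|x1 p IH] x.
  by exists F; split=> // z y; rewrite eqxx.
case/andP=> /existsP[y /and3P[Hxy nFxy Fx1y]] pth; rewrite cons_uniq => /andP[xNp Up].
(* The tail is flipped first. By uniqueness it leaves row [x] untouched, and row [x1] loses no edge
   in it, so [x1 y] is still there to be traded for [x y]. *)
have [F1 [[F1N F1x F1l] F1r F1c F1H F1d]] := IH x1 pth Up.
have nxx1 : (x == x1) = false.
  by apply: contraNF xNp => /eqP->; rewrite mem_head.
have nxl : (x == last x1 p) = false.
  by apply: contraNF xNp => /eqP->; rewrite mem_last.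
exists (upd (upd F1 x y true) x1 y false); split; first split.
- move=> z; rewrite in_cons negb_or => /andP[zx zp] y'.
  rewrite /upd (negPf zx) /=; case: eqP => [zx1|_]; last by rewrite F1N.
  by rewrite zx1 mem_head in zp.
- by move=> y' Fxy'; rewrite /upd nxx1 /=; case: ifP => // _; rewrite F1N.
- move=> y'; rewrite /= /upd (eq_sym _ x) nxl /=.
  by case: ifP => // _; apply: F1l.
- move=> z; have := rdeg_upd (upd F1 x y true) x1 y false z.
  have := rdeg_upd F1 x y true z; have := F1r z.
  rewrite (F1N _ xNp) (negPf nFxy) /upd (eq_sym x1) nxx1 /= (F1x _ Fx1y).
  by clear; case: (z == x); case: (z == x1); lia.
- move=> u; have := cdeg_upd (upd F1 x y true) x1 y false u.
  have := cdeg_upd F1 x y true u; have := F1c u.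
  rewrite (F1N _ xNp) (negPf nFxy) /upd (eq_sym x1) nxx1 /= (F1x _ Fx1y).
  by clear; case: (u == y); lia.
- move=> z y'; rewrite /upd; case: ifP => // _; case: ifP => [/andP[/eqP-> /eqP->]//|_].
  exact: F1H.
- move=> z y'; rewrite /upd; case: ifP => [/andP[/eqP-> /eqP->] _|_].
    by split; [rewrite !inE eqxx orbT | exists x; rewrite ?mem_head // Hxy].
  case: ifP => [/andP[/eqP-> /eqP->] _|_].
    by split; [rewrite !inE eqxx | exists x; rewrite ?mem_head // Hxy].
  case/F1d=> zp [w wp Hw]; split; first by rewrite in_cons zp orbT.
  by exists w; rewrite // in_cons wp orbT.
Qed.

Lemma rdeg_delete F w (B : {set Y}) x :
  (forall y, y \in B -> F w y) ->
  rdeg (fun x y => F x y && ~~ ((x == w) && (y \in B))) x + (x == w) * #|B|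
  = rdeg F x.
Proof.
move=> sB; rewrite /rdeg; case: eqP => [->|_]; last first.
  by rewrite addn0; apply: eq_bigr => y _; rewrite andbT.
rewrite mul1n -sum1_card [X in _ + X]big_mkcond -big_split /=.
apply: eq_bigr => y _; have := sB y.
by case: (y \in B) => [->|_] //; case: (F w y).
Qed.

Lemma cdeg_delete F w (B : {set Y}) y :
  (forall y, y \in B -> F w y) ->
  cdeg (fun x y => F x y && ~~ ((x == w) && (y \in B))) y + (y \in B)
  = cdeg F y.
Proof.
move=> sB; rewrite /cdeg (bigD1 w) //= [RHS](bigD1 w) //= eqxx.
rewrite (eq_bigr (fun j => F j y : nat)); last first.
  by move=> j /negPf->; rewrite andbT.
by have := sB y; case: (y \in B) => [->|_] //; case: (F w y) => //=; lia.
Qed.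

Lemma cdeg_insert F u (B : {set X}) y :
  (forall x, x \in B -> ~~ F x u) ->
  cdeg (fun x y => F x y || ((y == u) && (x \in B))) y
  = cdeg F y + (y == u) * #|B|.
Proof.
move=> sB; rewrite /cdeg; case: eqP => [->|_]; last first.
  by rewrite addn0; apply: eq_bigr => x _; rewrite orbF.
rewrite mul1n -sum1_card [X in _ + X]big_mkcond -big_split /=.
apply: eq_bigr => x _; have := sB x.
by case: (x \in B) => [/(_ isT)/negPf->|_] //; case: (F x u).
Qed.

Lemma rdeg_insert F u (B : {set X}) x :
  (forall x, x \in B -> ~~ F x u) ->
  rdeg (fun x y => F x y || ((y == u) && (x \in B))) x
  = rdeg F x + (x \in B).
Proof.
move=> sB; rewrite /rdeg (bigD1 u) //= [in RHS](bigD1 u) //= eqxx.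
rewrite (eq_bigr (fun j => F x j : nat)); last first.
  by move=> j /negPf->; rewrite orbF.
have := sB x; case: (x \in B) => [/(_ isT)/negPf->|_] //; last by rewrite orbF addn0.
by rewrite /= addnC add0n.
Qed.

End Bipartite.

(** * Reducing the total degree defect of a bipartite subgraph *)

Lemma sum_card (T : finType) (P : pred T) (f : T -> bool) :
  \sum_(i | P i) f i = #|[set i | P i && f i]|.
Proof.
rewrite -sum1_card big_mkcond [RHS]big_mkcond; apply: eq_bigr => i _.
by rewrite inE; case: (P i) => //; case: (f i).
Qed.

Lemma sum_ltn_at (I : finType) (P : pred I) (f g : I -> nat) i0 :
  P i0 -> (forall i, P i -> f i <= g i) -> f i0 < g i0 ->
  \sum_(i | P i) f i < \sum_(i | P i) g i.
Proof.
move=> Pi0 le_fg lt0; rewrite (bigD1 i0) // [X in _ < X](bigD1 i0) //= -addSn.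
by apply: leq_add => //; apply: leq_sum => i /andP[Pi _]; apply: le_fg.
Qed.

(** These are the inequalities behind the final count of [improve_row_defect]: rows aiming low or
    high need [2 * l <= d] or [2 * h <= d + l + 2], columns aiming low or high need [h <= 2 * l + 3]
    or [d <= 2 * h + 2]. The bound [l < h] serves when a target is switched. *)
Definition admissible l h d :=
  [&& 2 * l <= d, d <= 2 * h + 2, l < h, h <= 2 * l + 3 & 2 * h <= d + l + 2].

Definition target (s : bool) (l h : nat) := if s then h else l.

Section Improve.
Variables (X Y : finType) (H : X -> Y -> bool).
Variables (lX hX : X -> nat) (lY hY : Y -> nat).

(** The targets chosen by [sX] and [sY] vary together with [F]. Overshooting by one is free and only
    a shortfall counts as defect, so zero defect means that every degree is its target or one
    more. *)
Definition fits (F : X -> Y -> bool) (sX : X -> bool) (sY : Y -> bool) :=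
  [/\ forall x y, F x y -> H x y,
      forall x, rdeg F x <= (target (sX x) (lX x) (hX x)).+1 &
      forall y, cdeg F y <= (target (sY y) (lY y) (hY y)).+1].

Definition row_defect (F : X -> Y -> bool) (sX : X -> bool) x :=
  target (sX x) (lX x) (hX x) - rdeg F x.
Definition col_defect (F : X -> Y -> bool) (sY : Y -> bool) y :=
  target (sY y) (lY y) (hY y) - cdeg F y.
Definition defect F sX sY :=
  \sum_x row_defect F sX x + \sum_y col_defect F sY y.

Hypothesis admX : forall x, admissible (lX x) (hX x) (rdeg H x).
Hypothesis admY : forall y, admissible (lY y) (hY y) (cdeg H y).

(* [P] and [Q] are the rows and columns reached from the deficient row [x0] by
   alternating paths that start with an edge outside [F]. *)
Lemma improve_row_defect F sX sY x0 :
  fits F sX sY -> 0 < row_defect F sX x0 ->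
  exists F' sX' sY', fits F' sX' sY' /\ defect F' sX' sY' < defect F sX sY.
Proof.
case=> sFH rF cF def0; set goal := (ex _).
pose P := [set x | connect (alt_step H F) x0 x].
pose Q := [set y | [exists x, [&& x \in P, H x y & ~~ F x y]]].
have P0 : x0 \in P by rewrite inE connect0.
have QP x y : y \in Q -> F x y -> x \in P.
  rewrite inE => /existsP[w /and3P[Pw Hwy nFwy]] Fxy.
  move: Pw; rewrite !inE => /connect_trans; apply; apply: connect1; apply/existsP; exists y.
  by rewrite Hwy nFwy Fxy.
have PQ x y : x \in P -> H x y -> ~~ F x y -> y \in Q.
  by move=> Px Hxy nF; rewrite inE; apply/existsP; exists x; rewrite Px Hxy nF.
have decr F' sX' sY' : fits F' sX' sY' ->
    (forall x, row_defect F' sX' x <= row_defect F sX x) ->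
    (forall y, col_defect F' sY' y <= col_defect F sY y) ->
    row_defect F' sX' x0 < row_defect F sX x0 -> goal.
  move=> fit' leX leY lt0; exists F', sX', sY'; split=> //.
  rewrite /defect -addSn leq_add ?leq_sum //.
  exact: (@sum_ltn_at _ _ _ _ x0).
(* Flipping a path from [x0] to [w] gives [x0] a unit taken from [w]. All changes stay inside the
   block of [P] and [Q]. *)
have flip w : w \in P -> exists F', [/\
    (forall x, rdeg F' x + (x == w) = rdeg F x + (x == x0)),
    (forall y, cdeg F' y = cdeg F y), (forall x y, F' x y -> H x y),
    (forall x y, x \notin P \/ y \notin Q -> F' x y = F x y) &
    (forall y, F' w y -> F w y)].
  rewrite inE => /connectP[p0 /shortenP[p pth Up _] ->].
  have [F' [[_ _ F'l] F'r F'c F'H F'd]] := alternating_path_flip sFH pth Up.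
  exists F'; split=> // x y nPQ; apply/eqP; apply/negPn/negP => /F'd[xp [z zp]].
  move/andP=> [Hzy nFzy].
  have sub t : t \in x0 :: p -> t \in P.
    by move=> tp; rewrite inE; apply: (path_connect pth).
  case: nPQ; first by rewrite sub.
  by rewrite (PQ z) // sub.
have rowD F' : (forall x y, x \notin P \/ y \notin Q -> F' x y = F x y) ->
    forall x, rdeg F' x = \sum_(y in Q) F' x y + \sum_(y | y \notin Q) F x y.
  move=> F'd x; rewrite /rdeg (bigID (mem Q)) /=; congr (_ + _).
  by apply: eq_bigr => y nQ; rewrite F'd //; right.
have colD F' : (forall x y, x \notin P \/ y \notin Q -> F' x y = F x y) ->
    forall y, cdeg F' y = \sum_(x in P) F' x y + \sum_(x | x \notin P) F x y.
  move=> F'd y; rewrite /cdeg (bigID (mem P)) /=; congr (_ + _).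
  by apply: eq_bigr => x nP; rewrite F'd //; left.
pose tX x := target (sX x) (lX x) (hX x).
pose tY y := target (sY y) (lY y) (hY y).
have lt0 : rdeg F x0 < tX x0 by move: def0; rewrite /row_defect -/(tX x0); lia.
(* If a column [u] of [Q] has room for an edge, a flip to a suitable [w] followed by adding [w u]
   serves [x0] at no cost to [w]. *)
have [/existsP[u /andP[Qu leu]]|/existsPn colF] :=
  boolP [exists u, (u \in Q) && (cdeg F u <= tY u)].
  have := Qu; rewrite inE => /existsP[w /and3P[Pw Hwu nFwu]].
  have [F' [F'r F'c F'H F'd F'w]] := flip w Pw.
  have nF'wu : F' w u = false by apply: contraNF nFwu => /F'w.
  have r2 x : rdeg (upd F' w u true) x = rdeg F x + (x == x0).
    by have := rdeg_upd F' w u true x; have := F'r x; rewrite nF'wu muln0 muln1; clear; lia.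
  have c2 y : cdeg (upd F' w u true) y = cdeg F y + (y == u).
    by have := cdeg_upd F' w u true y; have := F'c y; rewrite nF'wu muln0 muln1; clear; lia.
  apply: (decr (upd F' w u true) sX sY).
  - split=> [x y|x|y].
    + by rewrite /upd; case: ifP => [/andP[/eqP-> /eqP->]//|_ /F'H].
    + rewrite r2 -/(tX x); have := rF x; rewrite -/(tX x).
      by move: lt0 leu; clear; case: eqP => [->|_] /=; lia.
    + rewrite c2 -/(tY y); have := cF y; rewrite -/(tY y).
      by move: lt0 leu; clear; case: eqP => [->|_] /=; lia.
  - by move=> x; rewrite /row_defect r2 leq_sub2l // leq_addr.
  - by move=> y; rewrite /col_defect c2 leq_sub2l // leq_addr.
  - by rewrite /row_defect r2 eqxx -/(tX x0); lia.
have {}colF u : u \in Q -> cdeg F u = (tY u).+1.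
  by move=> Qu; have := colF u; have := cF u; rewrite Qu -/(tY u) /=; lia.
(* A row of [P] above its target can hand its surplus unit to [x0]. *)
have [/existsP[w /andP[Pw ltw]]|/existsPn rowF] :=
  boolP [exists w, (w \in P) && (tX w < rdeg F w)].
  have [F' [F'r F'c F'H F'd F'w]] := flip w Pw.
  have nw0 : w != x0 by apply: contraTneq ltw => ->; lia.
  apply: (decr F' sX sY).
  - split=> // [x|y]; last by rewrite F'c.
    have := F'r x; have := rF x; rewrite -/(tX x).
    by have [->|] := eqVneq x x0; lia.
  - move=> x; rewrite /row_defect -/(tX x); have := F'r x.
    by have [->|] := eqVneq x w; lia.
  - by move=> y; rewrite /col_defect F'c.
  - by rewrite /row_defect -/(tX x0); have := F'r x0; rewrite eq_sym eqxx (negPf nw0); lia.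
have {}rowF w : w \in P -> rdeg F w <= tX w.
  by move=> Pw; have := rowF w; rewrite Pw /=; lia.
(* A row of [P] aiming high may instead aim low, by dropping edges into [Q],
   whose columns can each spare one. *)
have [/existsP[w /and3P[Pw sw lew]]|/existsPn rowS] :=
  boolP [exists w, [&& w \in P, sX w &
                       rdeg F w <= \sum_(y in Q) F w y + lX w + 1]].
  have [F' [F'r F'c F'H F'd F'w]] := flip w Pw.
  have tw : tX w = hX w by rewrite /tX sw.
  pose A := [set y | (y \in Q) && F' w y].
  (* This many deletions bring the row down to at most [lX w + 1], as the low target demands. *)
  have [|B sB cB] := @exists_subset_card _ A (rdeg F' w - (lX w).+1).
    rewrite -sum_card; have := F'r w; have := rowD F' F'd w.
    by have := rowD F (fun _ _ _ => erefl) w; rewrite eqxx; lia.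
  have sBF y : y \in B -> F' w y by move/(subsetP sB); rewrite inE => /andP[].
  pose F2 x y := F' x y && ~~ ((x == w) && (y \in B)).
  have r2 x : rdeg F2 x + (x == w) * (rdeg F' w - (lX w).+1) = rdeg F' x.
    by rewrite -cB; apply: rdeg_delete.
  have c2 y : cdeg F2 y + (y \in B) = cdeg F y.
    by rewrite -F'c; apply: cdeg_delete.
  have /and5P[_ _ ltlh _ _] := admX w.
  pose s2 x := if x == w then false else sX x.
  have s2E x : x != w -> target (s2 x) (lX x) (hX x) = tX x.
    by rewrite /s2 => /negPf->.
  have s2w : target (s2 w) (lX w) (hX w) = lX w by rewrite /s2 eqxx.
  have r2w : rdeg F2 w = minn (rdeg F' w) (lX w).+1.
    by have := r2 w; rewrite eqxx mul1n; lia.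
  have r2N x : x != w -> rdeg F2 x = rdeg F x + (x == x0).
    by move=> nw; have := r2 x; have := F'r x; rewrite (negPf nw) mul0n; clear; lia.
  apply: (decr F2 s2 sY).
  - split=> [x y /andP[/F'H]//|x|y].
    + have [->|nw] := eqVneq x w; first by rewrite s2w r2w geq_minr.
      rewrite s2E // r2N //; have := rF x; rewrite -/(tX x).
      by move: lt0; clear; case: eqP => [->|_] /=; lia.
    + by have := c2 y; have := cF y; lia.
  - move=> x; rewrite /row_defect -/(tX x); have [->|nw] := eqVneq x w.
      by rewrite s2w tw r2w; have := F'r w; rewrite eqxx; lia.
    by rewrite s2E // r2N //; clear; lia.
  - move=> y; rewrite /col_defect -/(tY y); have := c2 y.
    have [yB|] := boolP (y \in B); last by lia.
    have := subsetP sB _ yB; rewrite inE => /andP[/colF-> _]; lia.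
  - rewrite /row_defect -/(tX x0); have [w0|nw] := eqVneq w x0.
      rewrite -w0 s2w tw r2w; move: lt0; rewrite -w0 tw.
      by have := F'r w; rewrite -w0 eqxx; lia.
    by rewrite s2E 1?eq_sym // r2N 1?eq_sym // eqxx; lia.
(* Dually, a column of [Q] aiming low may aim high, by adding edges from [P]. *)
have [/existsP[u /and3P[Qu su leu]]|/existsPn colS] :=
  boolP [exists u, [&& u \in Q, ~~ sY u &
                       hY u <= \sum_(x in P) (H x u && ~~ F x u) + lY u + 1]].
  have := Qu; rewrite inE => /existsP[w /and3P[Pw Hwu nFwu]].
  have [F' [F'r F'c F'H F'd F'w]] := flip w Pw.
  have nF'wu : F' w u = false by apply: contraNF nFwu => /F'w.
  have tu : tY u = lY u by rewrite /tY (negPf su).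
  have /and5P[_ _ ltlh _ _] := admY u.
  pose A := [set x | (x \in P) && (H x u && ~~ F' x u)].
  have splitH (G : X -> Y -> bool) : (forall x y, G x y -> H x y) ->
      \sum_(x in P) (H x u && ~~ G x u) + \sum_(x in P) G x u = \sum_(x in P) H x u.
    move=> sG; rewrite -big_split; apply: eq_bigr => x _.
    by have := sG x u; case: (G x u) => [->|_]; case: (H x u).
  have cA : #|A| = \sum_(x in P) (H x u && ~~ F x u).
    rewrite -sum_card; have := splitH F' F'H; have := splitH F sFH.
    by have := colD F' F'd u; have := colD F (fun _ _ _ => erefl) u; rewrite F'c; clear; lia.
  (* Column [u] has degree [lY u + 1], so [n] more edges reach [hY u]. An edge at [w] is always
     included, even for [n = 0], to repay the unit that the flip took; the degree is then at most
     [hY u + 1]. *)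
  pose n := hY u - lY u - 1.
  have Aw : w \in A by rewrite inE Pw Hwu nF'wu.
  have [B [sB Bw cB]] : exists B : {set X}, [/\ B \subset A, w \in B &
     #|B| = maxn 1 n].
    have [|B [sB Bw cB]] := @exists_subset_card_mem _ A w (n - 1) Aw.
      by have : 0 < #|A| by [apply/card_gt0P; exists w]; move: leu; rewrite -cA /n; clear; lia.
    by exists B; split=> //; rewrite cB; clear; lia.
  have sBF x : x \in B -> ~~ F' x u.
    by move/(subsetP sB); rewrite inE => /and3P[].
  pose F2 x y := F' x y || ((y == u) && (x \in B)).
  have r2 x : rdeg F2 x = rdeg F' x + (x \in B) by apply: rdeg_insert.
  have c2 y : cdeg F2 y = cdeg F y + (y == u) * maxn 1 n.
    by rewrite -cB -F'c; apply: cdeg_insert.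
  pose s2 y := if y == u then true else sY y.
  have s2E y : y != u -> target (s2 y) (lY y) (hY y) = tY y.
    by rewrite /s2 => /negPf->.
  have s2u : target (s2 u) (lY u) (hY u) = hY u by rewrite /s2 eqxx.
  have c2u : cdeg F2 u = (lY u).+1 + maxn 1 n.
    by rewrite c2 eqxx mul1n colF // tu.
  have c2N y : y != u -> cdeg F2 y = cdeg F y.
    by move=> nu; rewrite c2 (negPf nu) addn0.
  have r2ge x : rdeg F x + (x == x0) <= rdeg F2 x.
    by rewrite r2 -F'r leq_add2l; case: eqP => [->|//]; rewrite Bw.
  apply: (decr F2 sX s2).
  - split=> [x y|x|y].
    + case/orP=> [/F'H//|/andP[/eqP-> /(subsetP sB)]].
      by rewrite inE => /and3P[].
    + rewrite -/(tX x) r2; have := F'r x.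
      have [xB|_] := boolP (x \in B).
        have := subsetP sB _ xB; rewrite inE => /andP[/rowF] lex _.
        by move: lt0 lex; clear; case: (eqVneq x x0) => [->|_]; lia.
      by have := rF x; rewrite -/(tX x); move: lt0; clear; case: (eqVneq x x0) => [->|_]; lia.
    + have [->|nu] := eqVneq y u; first by rewrite s2u c2u /n; move: ltlh; clear; lia.
      by rewrite s2E // c2N.
  - move=> x; rewrite /row_defect leq_sub2l //.
    by have := r2ge x; clear; lia.
  - move=> y; rewrite /col_defect -/(tY y); have [->|nu] := eqVneq y u.
      by rewrite s2u c2u /n; move: ltlh; clear; lia.
    by rewrite s2E // c2N.
  - by rewrite /row_defect -/(tX x0); have := r2ge x0; rewrite eqxx; move: lt0; clear; lia.
(* No improvement is left: [F] then uses less than half of the edges between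
   [P] and [Q] as counted by rows, but at least half as counted by columns. *)
have rowB w : w \in P ->
    2 * \sum_(y in Q) F w y + (rdeg F w < tX w) <= \sum_(y in Q) H w y.
  move=> Pw; have := rowF w Pw; have := rowS w; rewrite Pw /=.
  (* An edge of [H] outside [F] at a row of [P] would put its column into [Q]. *)
  have outQ : \sum_(y | y \notin Q) F w y = \sum_(y | y \notin Q) H w y.
    apply: eq_bigr => y nQ; have := sFH w y; have := PQ w y Pw.
    by case: (F w y) => [_ ->|] //; case: (H w y) => // /(_ isT isT); rewrite (negPf nQ).
  have := rowD F (fun _ _ _ => erefl) w.
  have : rdeg H w = \sum_(y in Q) H w y + \sum_(y | y \notin Q) H w y.
    by rewrite /rdeg (bigID (mem Q)).
  have /and5P[a1 a2 a3 a4 a5] := admX w; move: a1 a2 a3 a4 a5.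
  rewrite outQ /tX; clear; case: (sX w) => /=; lia.
have colB u : u \in Q -> \sum_(x in P) H x u <= 2 * \sum_(x in P) F x u.
  move=> Qu; have := colF u Qu; have := colS u; rewrite Qu /=.
  have outP : \sum_(x | x \notin P) F x u = 0.
    apply: big1 => x nP; have := QP x u Qu.
    by case: (F x u) => // /(_ isT); rewrite (negPf nP).
  have := colD F (fun _ _ _ => erefl) u.
  have : cdeg H u = \sum_(x in P) H x u + \sum_(x | x \notin P) H x u.
    by rewrite /cdeg (bigID (mem P)).
  have : \sum_(x in P) (H x u && ~~ F x u) + \sum_(x in P) F x u
         = \sum_(x in P) H x u.
    rewrite -big_split; apply: eq_bigr => x _.
    by have := sFH x u; case: (F x u) => [->|_]; case: (H x u).
  have /and5P[a1 a2 a3 a4 a5] := admY u; move: a1 a2 a3 a4 a5.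
  rewrite outP /tY; clear; case: (sY u) => /=; lia.
have : \sum_(x in P) 2 * \sum_(y in Q) F x y < \sum_(x in P) \sum_(y in Q) H x y.
  apply: (@sum_ltn_at _ _ _ _ x0) => // [x /rowB|]; first by clear; lia.
  by have := rowB _ P0; rewrite lt0; clear; lia.
rewrite -big_distrr /= exchange_big [X in _ < X]exchange_big big_distrr /=.
by rewrite ltnNge => /negP[]; apply: leq_sum => y Qy; apply: colB.
Qed.
End Improve.

(** * Subgraphs with prescribed degree lists, and maximum cuts *)

Definition in_list l h n := (l <= n <= l.+1) || (h <= n <= h.+1).

Lemma target_in_list s l h n :
  n <= (target s l h).+1 -> target s l h - n = 0 -> in_list l h n.
Proof. by rewrite /in_list; case: s => /=; lia. Qed.

(** Descent on the defect, starting from the empty subgraph with all targets low; a deficient column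
    is treated as a row of the transposed graph. *)
Theorem bipartite_degree_lists (X Y : finType) (H : X -> Y -> bool)
    (lX hX : X -> nat) (lY hY : Y -> nat) :
  (forall x, admissible (lX x) (hX x) (rdeg H x)) ->
  (forall y, admissible (lY y) (hY y) (cdeg H y)) ->
  exists F : X -> Y -> bool,
    [/\ forall x y, F x y -> H x y,
        forall x, in_list (lX x) (hX x) (rdeg F x) &
        forall y, in_list (lY y) (hY y) (cdeg F y)].
Proof.
move=> admX admY; set goal := (ex _).
suff main n F sX sY : fits H lX hX lY hY F sX sY ->
    defect lX hX lY hY F sX sY <= n -> goal.
  apply: (main _ (fun _ _ => false) (fun _ => false) (fun _ => false)) (leqnn _).
  by split=> // z; rewrite /rdeg /cdeg big1.
elim/ltn_ind: n F sX sY => n IH F sX sY fit ledef.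
have improve F' sX' sY' : fits H lX hX lY hY F' sX' sY' ->
    defect lX hX lY hY F' sX' sY' < defect lX hX lY hY F sX sY -> goal.
  by move=> fit' lt'; apply: (IH _ (leq_trans lt' ledef)) fit' (leqnn _).
have [/existsP[x0 d0]|/existsPn dX] := boolP [exists x, 0 < row_defect lX hX F sX x].
  have [F' [sX' [sY' [fit' lt']]]] := improve_row_defect admX admY fit d0.
  exact: improve fit' lt'.
have [/existsP[y0 d0]|/existsPn dY] := boolP [exists y, 0 < col_defect lY hY F sY y].
  pose tr (G : X -> Y -> bool) y x := G x y.
  have fitT : fits (tr H) lY hY lX hX (tr F) sY sX.
    by case: fit => sFH rF cF; split=> // y x; apply: sFH.
  have [F' [sY' [sX' [fit' lt']]]] := improve_row_defect admY admX fitT d0.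
  apply: (improve (fun x y => F' y x) sX' sY').
    by case: fit' => sFH rF cF; split=> // x y; apply: sFH.
  by move: lt'; rewrite /defect addnC [X in _ < X]addnC.
case: fit => sFH rF cF; exists F; split=> // z; apply: target_in_list.
- exact: rF.
- by apply/eqP; have := dX z; rewrite lt0n negbK.
- exact: cF.
- by apply/eqP; have := dY z; rewrite lt0n negbK.
Qed.

Theorem cut_degree_lists (T : finType) (e : rel T) (b : T -> bool)
    (l h : T -> nat) : symmetric e ->
  (forall v, admissible (l v) (h v) (\sum_u (e v u && (b v != b u)))) ->
  exists F : rel T,
    [/\ symmetric F, forall u v, F u v -> e u v &
        forall v, in_list (l v) (h v) (rdeg F v)].
Proof.
move=> symE adm; pose H u v := [&& e u v, b u & ~~ b v].
(* Both classes are copies of [T], so each vertex is isolated in one of them; there the values 0 and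
   1 are admissible for degree 0. *)
pose lX v := if b v then l v else 0; pose hX v := if b v then h v else 1.
pose lY v := if b v then 0 else l v; pose hY v := if b v then 1 else h v.
have [||G [sG rG cG]] := @bipartite_degree_lists T T H lX hX lY hY.
- move=> v; rewrite /lX /hX; case bv: (b v).
    rewrite (_ : rdeg H v = \sum_u (e v u && (b v != b u))) //.
    by apply: eq_bigr => u _; rewrite /H bv; case: (b u).
  by rewrite /rdeg big1 // => u _; rewrite /H bv andbF.
- move=> v; rewrite /lY /hY; case bv: (b v).
    by rewrite /cdeg big1 // => u _; rewrite /H bv !andbF.
  rewrite (_ : cdeg H v = \sum_u (e v u && (b v != b u))) //.
  by apply: eq_bigr => u _; rewrite /H bv symE; case: (b u).
exists (fun u v => G u v || G v u); split=> [u v|u v|v].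
- by rewrite orbC.
- by case/orP=> /sG/and3P[] //; rewrite symE.
- have := rG v; have := cG v; rewrite /lX /hX /lY /hY; case bv: (b v) => cv rv.
    rewrite (_ : rdeg _ v = rdeg G v) //; apply: eq_bigr => u _.
    by have := sG u v; rewrite /H bv !andbF; case: (G u v) => // [/(_ isT)|]; rewrite ?orbF.
  rewrite (_ : rdeg _ v = cdeg G v) //; apply: eq_bigr => u _.
  by have := sG v u; rewrite /H bv !andbF; case: (G v u) => // /(_ isT).
Qed.

(** In a colouring with fewest monochromatic edges, moving [v] to class [j] gains nothing, so [v]
    has at most as many neighbours in its own class as in class [j]. Summing over [j] gives the
    bound. *)
Lemma max_cut (T C : finType) (c0 : C) (e : rel T) :
  symmetric e -> irreflexive e ->
  exists r : T -> C,
    forall v, #|C| * \sum_u (e v u && (r v == r u)) <= rdeg e v.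
Proof.
move=> symE irrE.
pose cost (r : {ffun T -> C}) := \sum_x \sum_y (e x y && (r x == r y)).
case: (arg_minnP cost (i0 := [ffun=> c0]) (P := xpredT)) => // r _ minr.
(* [cost] counts ordered pairs, hence the factor 2; the second sum does not depend on [s v]. *)
have costE v s : cost s = 2 * \sum_u (e v u && (s v == s u)) +
    \sum_(x | x != v) \sum_(y | y != v) (e x y && (s x == s y)).
  rewrite /cost (bigD1 v) //= mul2n -addnn -addnA; congr (_ + _).
  have -> : \sum_u (e v u && (s v == s u)) =
            \sum_(x | x != v) (e x v && (s x == s v)).
    rewrite (bigD1 v) //= irrE add0n; apply: eq_bigr => x _.
    by rewrite symE eq_sym.
  by rewrite -big_split; apply: eq_bigr => x _; rewrite (bigD1 v).
have le_col v j : \sum_u (e v u && (r v == r u)) <= \sum_u (e v u && (j == r u)).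
  pose s := [ffun x => if x == v then j else r x].
  have := minr s isT; rewrite !(costE v).
  have -> : \sum_u (e v u && (s v == s u)) = \sum_u (e v u && (j == r u)).
    apply: eq_bigr => u _; rewrite !ffunE eqxx.
    by case: (eqVneq u v) => [->|//]; rewrite irrE.
  rewrite [X in _ <= _ + X](eq_bigr (fun x => \sum_(y | y != v) (e x y && (r x == r y)))).
    by rewrite leq_add2r leq_mul2l.
  move=> x /negPf xv; apply: eq_bigr => y /negPf yv.
  by rewrite !ffunE xv yv.
exists r => v; rewrite -sum_nat_const.
apply: (leq_trans (leq_sum _ (fun j _ => le_col v j))).
rewrite exchange_big; apply: leq_sum => u _.
rewrite (bigD1 (r u)) //= eqxx andbT big1 ?addn0 // => j /negPf->.
by rewrite andbF.
Qed.

(** * Weightings from subgraphs, and the red class *)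

Lemma wdeg_succ (T : finType) (F G : rel T) v :
  (forall u v, G u v -> F u v) ->
  wdeg F (fun u v => (G u v).+1) v = rdeg F v + rdeg G v.
Proof.
move=> sGF; rewrite /wdeg /rdeg big_mkcond -big_split; apply: eq_bigr => u _.
by have := sGF v u; case: (F v u); case: (G v u) => // /(_ isT).
Qed.

(** Edges of [G] get weight 2 and the other edges of [F] weight 1. *)
Lemma weight12_of_subgraph (T : finType) (F G : rel T) :
  symmetric G -> (forall u v, G u v -> F u v) ->
  (forall u v, F u v -> rdeg F u + rdeg G u <> rdeg F v + rdeg G v) ->
  weight12_colourable F.
Proof.
move=> symG sGF neq; exists (fun u v => (G u v).+1); split; last split.
- by move=> u v _; rewrite symG.
- by move=> u v _; case: (G u v); [right|left].
- by move=> u v Fuv; rewrite !wdeg_succ //; apply: neq.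
Qed.

Lemma leq_rdeg (T : finType) (F G : rel T) v :
  (forall u, G v u -> F v u) -> rdeg G v <= rdeg F v.
Proof.
by move=> sGF; apply: leq_sum => u _; have := sGF u; case: (G v u) => // ->.
Qed.

Lemma sum_cut (T : finType) (e : rel T) (C : eqType) (b : T -> C) v :
  \sum_u (e v u && (b v == b u)) + \sum_u (e v u && (b v != b u)) = rdeg e v.
Proof.
rewrite -big_split; apply: eq_bigr => u _.
by case: (e v u); case: (b v == b u).
Qed.

Lemma exists_residue a M k t :
  t < M -> M <= a -> exists l, [/\ l <= a, a < l + M & (k + l) %% M = t].
Proof.
move=> tM Ma; have M0 : 0 < M by lia.
have lt1 := ltn_pmod (k + a + (M - t)) M0.
exists (a - (k + a + (M - t)) %% M); split; [lia|lia|].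
set m := _ %% M in lt1 *; have := divn_eq (k + a + (M - t)) M; rewrite -/m => E.
have -> : k + (a - m) = ((k + a + (M - t)) %/ M - 1) * M + t.
  have : 0 < (k + a + (M - t)) %/ M by rewrite divn_gt0 //; lia.
  by move: ((k + a + (M - t)) %/ M) E => q; nia.
by rewrite modnMDl modn_small.
Qed.

(** From degree [16 * p] on, the sum modulo [2 * p] can be forced to reveal [r v]. Below that the
    sum is less than [32 * p], while every neighbour has a sum of at least [32 * p]. *)
Lemma residue_weight12 (T : finType) (R : rel T) p (r : T -> 'I_p) :
  symmetric R -> irreflexive R ->
  (forall u v, R u v -> r u != r v) ->
  (forall u v, R u v -> rdeg R u < 16 * p -> 32 * p <= rdeg R v) ->
  weight12_colourable R.
Proof.
move=> symR irrR neqr sep; have [b cutb] := max_cut true symR irrR.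
have half v : rdeg R v <= 2 * \sum_u (R v u && (b v != b u)).
  by have := cutb v; have := sum_cut R b v; rewrite card_bool; lia.
have [v|lh lhP] := fin_all_exists (T := T) (U := fun _ => (nat * nat)%type) (P := fun v x =>
    admissible x.1 x.2 (\sum_u (R v u && (b v != b u))) /\
    (16 * p <= rdeg R v -> forall n, in_list x.1 x.2 n ->
       (rdeg R v + n) %% (2 * p) %/ 2 = r v)).
  move: (half v) (ltn_ord (r v)); set d := \sum_u _ => le_d rp.
  have [big|small] := leqP (16 * p) (rdeg R v); last first.
    exists (d./2, d./2.+1); split; last by lia.
    by rewrite /admissible /=; lia.
  (* The values [l] and [l + 2 * p] straddle [d / 2] with one residue; they are close enough to be
     admissible because [d >= 8 * p]. *)
  have [||l [l1 l2 l3]] := @exists_residue d./2 (2 * p) (rdeg R v) (2 * r v).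
  - by lia.
  - by lia.
  exists (l, l + 2 * p); split; first by rewrite /admissible /=; lia.
  have res k : k <= 1 -> (rdeg R v + l + k) %% (2 * p) %/ 2 = r v.
    by move=> k1; rewrite -modnDml l3 modn_small; lia.
  move=> _ n /orP[] /= /andP[n1 n2].
    have -> : n = l + (n - l) by lia.
    by rewrite addnA res //; lia.
  have -> : n = l + (n - (l + 2 * p)) + 2 * p by lia.
  by rewrite addnA modnDr addnA res //; lia.
have adm v := (lhP v).1.
have [F [symF sFR inF]] := cut_degree_lists symR adm.
have lt_sep u v : R u v -> rdeg R u < 16 * p ->
    rdeg R u + rdeg F u < rdeg R v + rdeg F v.
  move=> Ruv small; have := sep u v Ruv small.
  have := leq_rdeg (fun u0 => sFR u u0); lia.
apply: (weight12_of_subgraph symF sFR) => u v Ruv Euv.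
have [bu|su] := leqP (16 * p) (rdeg R u); last first.
  by have := lt_sep u v Ruv su; rewrite Euv ltnn.
have [bv|sv] := leqP (16 * p) (rdeg R v); last first.
  by have := lt_sep v u; rewrite symR => /(_ Ruv sv); rewrite Euv ltnn.
have /eqP[] := neqr u v Ruv; apply: val_inj => /=.
by rewrite -((lhP u).2 bu _ (inF u)) -((lhP v).2 bv _ (inF v)) Euv.
Qed.

(** * The blue class by greedy choice of permitted sums *)

Lemma exists_avoiding (s : seq nat) x :
  exists2 i, i <= size s & x + 4 * i \notin s.
Proof.
have [/hasP[i]|/hasPn all_in] := boolP (has (fun i => x + 4 * i \notin s) (iota 0 (size s).+1)).
  by rewrite mem_iota add0n ltnS => le_i xi; exists i.
have sub : {subset [seq x + 4 * i | i <- iota 0 (size s).+1] <= s}.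
  by move=> y /mapP[i ii ->]; have := all_in i ii; rewrite negbK.
have /uniq_leq_size/(_ sub) : uniq [seq x + 4 * i | i <- iota 0 (size s).+1].
  by rewrite map_inj_uniq ?iota_uniq // => i j; lia.
by rewrite size_map size_iota ltnn.
Qed.

(** Vertices are treated one at a time. Extension is assumed against every total [g], so vertices
    not yet treated may carry the junk value [a0]. *)
Lemma greedy_assignment (T : finType) (A : Type) (a0 : A) (k : rel T)
    (ok : T -> A -> Prop) (compat : A -> A -> Prop) :
  symmetric k -> irreflexive k -> (forall x y, compat x y -> compat y x) ->
  (forall v (g : T -> A), exists2 x, ok v x & forall u, k v u -> compat x (g u)) ->
  exists2 g : T -> A, forall v, ok v (g v) & forall u v, k u v -> compat (g u) (g v).
Proof.
move=> symk irrk symc ext.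
suff main (s : seq T) : exists2 g : T -> A, {in s, forall v, ok v (g v)} &
    {in s &, forall u v, k u v -> compat (g u) (g v)}.
  have [g okg cg] := main (enum T).
  by exists g => [v|u v]; [apply: okg | apply: cg]; rewrite mem_enum.
elim: s => [|v s [g okg cg]]; first by exists (fun=> a0).
have [x okx cx] := ext v g.
exists (fun u => if u == v then x else g u) => [u|u w].
  by rewrite inE; case: eqP => [->|_] //=; apply: okg.
rewrite !inE; case: eqP => [->|_] /= us; case: eqP => [->|_] /= ws.
- by rewrite irrk.
- exact: cx.
- by rewrite symk => /cx/symc.
- exact: cg.
Qed.

Lemma list_weight12 (T : finType) (B : rel T) (b : T -> bool) :
  symmetric B -> irreflexive B ->
  (forall v, 48 * \sum_u (B v u && (b v == b u)) + 100
             <= \sum_u (B v u && (b v != b u))) ->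
  weight12_colourable B.
Proof.
move=> symB irrB room.
pose k u v := B u v && (b u == b v).
pose ok v (x : nat * nat) := exists l h,
  [/\ x = (rdeg B v + l, rdeg B v + h),
      admissible l h (\sum_u (B v u && (b v != b u))),
      (rdeg B v + l) %% 4 = 2 * b v & (rdeg B v + h) %% 4 = 2 * b v].
pose compat (x y : nat * nat) :=
  [&& x.1 != y.1, x.1 != y.2, x.2 != y.1 & x.2 != y.2].
have [||||g okg cg] := @greedy_assignment T _ (0, 0) k ok compat.
- by move=> u v; rewrite /k symB eq_sym.
- by move=> v; rewrite /k irrB.
- by move=> [x1 x2] [y1 y2] /and4P[? ? ? ?]; apply/and4P; split; rewrite eq_sym.
- move=> v g; pose E := enum [set u | k v u].
  pose s := [seq (g u).1 | u <- E] ++ [seq (g u).2 | u <- E].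
  have sizeE : size s = 2 * \sum_u (B v u && (b v == b u)).
    rewrite size_cat !size_map -cardE (sum_card xpredT) mul2n -addnn.
    by congr (_ + _); apply: eq_card => u; rewrite !inE.
  move: (room v); set d := \sum_u (B v u && (b v != b u)) => le_d.
  have tb : 2 * b v < 4 by case: (b v).
  (* [l0] lies just above [d / 3] and [h0] just above [d / 2]. With [c] neighbours on the same side,
     [2 * c] values must be avoided, so steps of 4, which keep the residue, shift by at most
     [8 * c]. By [room] this is at most [d / 6 - 16], so the lower value stays below [d / 2] and the
     upper below [2 * d / 3]. *)
  have [|l0 [l1 l2 l3]] := @exists_residue (d %/ 3 + 4) 4 (rdeg B v) (2 * b v) tb.
    by lia.
  have [|h0 [h1 h2 h3]] := @exists_residue (d./2 + 4) 4 (rdeg B v) (2 * b v) tb.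
    by lia.
  have [i le_i iN] := exists_avoiding s (rdeg B v + l0).
  have [j le_j jN] := exists_avoiding s (rdeg B v + h0).
  exists (rdeg B v + l0 + 4 * i, rdeg B v + h0 + 4 * j).
    exists (l0 + 4 * i), (h0 + 4 * j); split; first by rewrite !addnA.
    - rewrite sizeE in le_i le_j; rewrite -/d /admissible.
      by move: l1 l2 h1 h2 le_i le_j le_d; clear; lia.
    - by rewrite addnA addnC mulnC modnMDl.
    - by rewrite addnA addnC mulnC modnMDl.
  move=> u kvu; have uE : u \in E by rewrite mem_enum inE.
  have s1 : (g u).1 \in s by rewrite mem_cat (map_f (fun u => (g u).1) uE).
  have s2 : (g u).2 \in s by rewrite mem_cat (map_f (fun u => (g u).2) uE) orbT.
  rewrite /compat /=; apply/and4P.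
  by split; [apply: contraNneq iN | apply: contraNneq iN |
             apply: contraNneq jN | apply: contraNneq jN] => ->.
have [lh lhP] := fin_all_exists (T := T) (U := fun _ => (nat * nat)%type) (P := fun v x =>
  [/\ g v = (rdeg B v + x.1, rdeg B v + x.2),
      admissible x.1 x.2 (\sum_u (B v u && (b v != b u))),
      (rdeg B v + x.1) %% 4 = 2 * b v & (rdeg B v + x.2) %% 4 = 2 * b v])
  (fun v => let: ex_intro l (ex_intro h P) := okg v in ex_intro _ (l, h) P).
have adm v : admissible (lh v).1 (lh v).2 (\sum_u (B v u && (b v != b u))).
  by case: (lhP v).
have [F [symF sFB inF]] := cut_degree_lists symB adm.
(* Both entries of [g v] are even, so rounding the sum down to an even number recovers one of
   them. *)
have sumP v : let s := rdeg B v + rdeg F v in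
    s %% 4 %/ 2 = b v /\ (2 * (s %/ 2) = (g v).1 \/ 2 * (s %/ 2) = (g v).2).
  have [-> _ m1 m2] := lhP v; have := inF v; rewrite /in_list /=.
  by move: m1 m2; clear; case: (b v) => /=; lia.
apply: (weight12_of_subgraph symF sFB) => u v Buv Euv.
have [/= bu gu] := sumP u; have [/= bv gv] := sumP v; rewrite Euv in bu gu.
have kuv : k u v by rewrite /k Buv; move: bu; rewrite bv; case: (b u); case: (b v).
have /and4P[/eqP n1 /eqP n2 /eqP n3 /eqP n4] := cg u v kuv.
by move: gu gv n1 n2 n3 n4; clear; lia.
Qed.

(** * Assembling the decomposition *)

(* The partition E = E1 ⊔ E2 is given by a symmetric edge labelling p:
   E1 = {uv in E | p u v}, E2 = {uv in E | ~~ p u v}. *)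
Theorem theorem6 (T : finType) (e : rel T) :
  simple_graph e -> min_deg_ge e (10 ^ 6) ->
  exists p : rel T,
    (forall u v, e u v -> p u v = p v u) /\
    weight12_colourable (fun u v => e u v && p u v) /\
    weight12_colourable (fun u v => e u v && ~~ p u v).
Proof.
move=> [symE irrE] mindeg.
have degE v : rdeg e v = deg e v.
  by rewrite /rdeg (sum_card xpredT); apply: eq_card => u; rewrite !inE.
have [b cutb] := max_cut true symE irrE.
pose side u v := e u v && (b u == b v).
have symS : symmetric side by move=> u v; rewrite /side symE eq_sym.
have irrS : irreflexive side by move=> v; rewrite /side irrE.
(* Keeping [p] opaque stops the large numerals from being unfolded. *)
have [p p100] : exists p, p = 10 * 10 by eexists.
have p0 : 0 < p by rewrite p100.
have [r cutr] := max_cut (Ordinal p0) symS irrS.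
pose R0 u v := side u v && (r u != r v).
pose S v := rdeg R0 v < 32 * p.
pose q u v := R0 u v && ~~ (S u && S v).
have symq : symmetric q.
  by move=> u v; rewrite /q /R0 symS eq_sym [S u && _]andbC.
exists q; split; first by move=> u v _; apply: symq.
have qe u v : q u v -> e u v by case/andP=> /andP[/andP[]].
(* Only edges with both ends in [S] are recoloured, so a vertex outside [S] keeps its whole red
   degree. *)
have bigR v : ~~ S v -> rdeg (fun u v => e u v && q u v) v >= 32 * p.
  move=> nSv; apply: (@leq_trans (rdeg R0 v)); first by rewrite leqNgt.
  apply: leq_rdeg => u R0vu; have qvu : q v u by rewrite /q R0vu (negPf nSv).
  by rewrite qvu qe.
split.
  apply: (residue_weight12 (r := r)) => [u v|v|u v|u v].
  - by rewrite symE symq.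
  - by rewrite irrE.
  - by case/and3P=> _ /andP[].
  - case/andP=> _ /andP[_ nS] small; apply: (bigR v).
    apply: contra nS => ->; rewrite andbT; apply: contraTT small => /bigR.
    by rewrite -leqNgt; lia.
apply: (list_weight12 (b := b)) => [u v|v|v].
- by rewrite symE symq.
- by rewrite irrE.
have -> : \sum_u (e v u && ~~ q v u && (b v != b u)) = \sum_u (e v u && (b v != b u)).
  apply: eq_bigr => u _; rewrite /q /R0 /side; case: (b v == b u); rewrite ?andbF //=.
  by rewrite andbT.
have conf : \sum_u (e v u && ~~ q v u && (b v == b u)) <=
   \sum_u (side v u && (r v == r u)) + \sum_u (R0 v u && S v).
  rewrite -big_split; apply: leq_sum => u _; rewrite /q /R0 /side.
  by case: (e v u); case: (b v == b u); case: (r v == r u); case: (S v); case: (S u).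
have small : \sum_u (R0 v u && S v) <= 32 * p.
  have [Sv|_] := boolP (S v); last by rewrite big1 // => u _; rewrite andbF.
  by apply: leq_trans (ltnW Sv); apply: leq_sum => u _; rewrite andbT.
(* For degree [D] there are at most [D / 200 + 3200] conflicts, and
   [48 * (D / 200 + 3200) + 100 <= D / 2] once [D >= 10 ^ 6]. *)
have := cutr v; have := cutb v; have := sum_cut e b v; have := mindeg v.
rewrite card_bool card_ord -degE; move: conf small.
have -> : \sum_u (e v u && (b v == b u)) = rdeg side v by [].
move: (\sum_u (side v u && (r v == r u))) (\sum_u (R0 v u && S v)) => x y.
move: (\sum_u (e v u && ~~ q v u && (b v == b u))) (rdeg side v) => c s.
move: (\sum_u (e v u && (b v != b u))) => d.
by rewrite p100 !expnS expn0; clear; lia.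
Qed.
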